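(* Let $(X,\triangleright)$ and $(Y,\bar\triangleright)$ be quandles (resp. racks, crossed sets). Let $f:X\to Y$ be a surjective morphism such that the fibers $f^{-1}(y)$, $y\in Y$, all have the same cardinality (this happens for instance if $X$ is indecomposable). Then $X$ is an extension $X\simeq Y\times_{\alpha}S$ of $Y$ by some non-empty set $S$, for some quandle (resp. rack, crossed set) dynamical cocycle $\alpha:Y\times Y\to \mathrm{Fun}(S\times S,S)$.
   Context: A rack is a pair $(X,\triangleright)$ where $X$ is a non-empty set and $\triangleright:X\times X\to X$ is such that each $\phi_i:X\to X$, $\phi_i(j)=i\triangleright j$, is a bijection and $i\triangleright(j\triangleright k)=(i\triangleright j)\triangleright(i\triangleright k)$ for all $i,j,k$. A quandle is a rack with $i\triangleright i=i$ for all $i$. A crossed set is a quandle such that $j\triangleright i=i$ whenever $i\triangleright j=j$. Morphisms are maps $\psi$ with $\psi(i\triangleright j)=\psi(i)\triangleright\psi(j)$. A subrack is a non-empty subset $Z$ with $Z\triangleright Z=Z$; a rack is decomposable if it is a disjoint union of two subracks, and indecomposable otherwise. Dynamical cocycle: let $Y$ be a rack and $S$ a non-empty set. A function $\alpha:Y\times Y\to\mathrm{Fun}(S\times S,S)$, $(i,j)\mapsto\alpha_{ij}$, with $\alpha_{ij}(s):S\to S$, $\alpha_{ij}(s)(t)=\alpha_{ij}(s,t)$, is a rack dynamical cocycle if every $\alpha_{ij}(s)$ is a bijection and $\alpha_{i,j\triangleright k}(s,\alpha_{jk}(t,u))=\alpha_{i\triangleright j,i\triangleright k}(\alpha_{ij}(s,t),\alpha_{ik}(s,u))$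 for all $i,j,k\in Y$, $s,t,u\in S$. If $Y$ is a quandle, $\alpha$ is a quandle dynamical cocycle if moreover $\alpha_{ii}(s,s)=s$ for all $i,s$. If $Y$ is a crossed set, $\alpha$ is a crossed set dynamical cocycle if moreover $\alpha_{ji}(t,s)=s$ whenever $i\triangleright j=j$ and $\alpha_{ij}(s,t)=t$. The extension $Y\times_\alpha S$ is the set $Y\times S$ with $(i,s)\triangleright(j,t)=(i\triangleright j,\alpha_{ij}(s,t))$; it is a rack (resp. quandle, crossed set). *)

(* Defs.v *)
From mathcomp Require Import all_boot.
From mathcomp Require Import boolp classical_sets functions cardinality.

Set Implicit Arguments.
Unset Strict Implicit.
Unset Printing Implicit Defensive.

Local Open Scope classical_set_scope.

Record is_rack (X : Type) (op : X -> X -> X) : Prop := IsRack {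
  rack_inhabited : inhabited X;
  rack_bijective : forall i, bijective (op i);
  rack_distributive : forall i j k, op i (op j k) = op (op i j) (op i k)
}.

Record is_quandle (X : Type) (op : X -> X -> X) : Prop := IsQuandle {
  quandle_rack : is_rack op;
  quandle_idempotent : forall i, op i i = i
}.

Record is_crossed_set (X : Type) (op : X -> X -> X) : Prop := IsCrossedSet {
  crossed_set_quandle : is_quandle op;
  crossed_set_fix : forall i j, op i j = j -> op j i = i
}.

Definition rack_morphism (X Y : Type) (opX : X -> X -> X) (opY : Y -> Y -> Y)
    (f : X -> Y) : Prop :=
  {morph f : i j / opX i j >-> opY i j}.

Definition rack_isomorphic (X Y : Type) (opX : X -> X -> X)
    (opY : Y -> Y -> Y) : Prop :=
  exists f : X -> Y, rack_morphism opX opY f /\ bijective f.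

Definition is_subrack (X : Type) (op : X -> X -> X) (Z : set X) : Prop :=
  Z !=set0 /\ [set op i j | i in Z & j in Z] = Z.

Definition decomposable (X : Type) (op : X -> X -> X) : Prop :=
  exists Z1 Z2 : set X,
    [/\ is_subrack op Z1, is_subrack op Z2,
        Z1 `&` Z2 = set0 & Z1 `|` Z2 = [set: X]].

Definition indecomposable (X : Type) (op : X -> X -> X) : Prop :=
  ~ decomposable op.

Definition equipotent_fibers (X Y : Type) (f : X -> Y) : Prop :=
  forall y y' : Y, (f @^-1` [set y] #= f @^-1` [set y'])%card.

(* alpha i j s t stands for alpha_{ij}(s, t), with Fun(S * S, S) curried. *)
Record rack_dynamical_cocycle (Y S : Type) (op : Y -> Y -> Y)
    (alpha : Y -> Y -> S -> S -> S) : Prop := RackDynamicalCocycle {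
  rack_cocycle_bijective : forall i j s, bijective (alpha i j s);
  rack_cocycle_distributive : forall i j k s t u,
    alpha i (op j k) s (alpha j k t u) =
    alpha (op i j) (op i k) (alpha i j s t) (alpha i k s u)
}.

Record quandle_dynamical_cocycle (Y S : Type) (op : Y -> Y -> Y)
    (alpha : Y -> Y -> S -> S -> S) : Prop := QuandleDynamicalCocycle {
  quandle_cocycle_rack : rack_dynamical_cocycle op alpha;
  quandle_cocycle_idempotent : forall i s, alpha i i s s = s
}.

Record crossed_set_dynamical_cocycle (Y S : Type) (op : Y -> Y -> Y)
    (alpha : Y -> Y -> S -> S -> S) : Prop := CrossedSetDynamicalCocycle {
  crossed_set_cocycle_quandle : quandle_dynamical_cocycle op alpha;
  crossed_set_cocycle_fix : forall i j s t,
    op i j = j -> alpha i j s t = t -> alpha j i t s = s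
}.

Definition extension_op (Y S : Type) (op : Y -> Y -> Y)
    (alpha : Y -> Y -> S -> S -> S) (p q : Y * S) : Y * S :=
  (op p.1 q.1, alpha p.1 q.1 p.2 q.2).

(* Main.v *)
Require Import Defs.
From mathcomp Require Import all_boot.
From mathcomp Require Import boolp classical_sets functions cardinality.

(** Choosing a bijection from every fiber of [f] onto one fixed fiber [S]
    identifies [X], as a set over [Y], with the projection [Y * S -> Y].  Carry
    the operation of [X] over to [Y * S].  As [f] is a morphism, the first
    component of the product of two pairs is forced to be the product in [Y],
    so the whole operation is [extension_op opY alpha], where [alpha] is its
    second component ([extension_of_equipotent_fibers]).  Being isomorphic to
    [X], this extension is a rack, quandle or crossed set as soon as [X] is, and
    the cocycle conditions are the second components of the corresponding
    axioms ([rack_cocycle_of_extension], [quandle_cocycle_of_extension],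
    [crossed_set_cocycle_of_extension]).

    For an indecomposable [X], left multiplication by [i] maps the fiber over
    [y] bijectively onto the fiber over [opY (f i) y].  Hence the set of points
    whose fiber is equipotent to a given one is preserved, in both directions,
    by all left multiplications, and so is its complement.  If both were
    non-empty they would be subracks decomposing [X]; so all fibers are
    equipotent ([equipotent_fibers_of_indecomposable]). *)

Set Implicit Arguments.
Unset Strict Implicit.
Unset Printing Implicit Defensive.

Section Transport.

Variables (X Z : Type) (opX : X -> X -> X) (opZ : Z -> Z -> Z).

Lemma rack_transport :
  rack_isomorphic opX opZ -> is_rack opX -> is_rack opZ.
Proof.
move=> [h [hM [g hK gK]]] [[x0] bijX distX]; split; first by exists; exact: h x0.
- move=> p; have [d dK Kd] := bijX (g p).
  have opE q : opZ p q = h (opX (g p) (g q)) by rewrite hM !gK.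
  exists (fun q => h (d (g q))) => q.
  + by rewrite opE hK dK gK.
  + by rewrite opE hK Kd gK.
- by move=> p q r; rewrite -(gK p) -(gK q) -(gK r) -!hM distX.
Qed.

Lemma quandle_transport :
  rack_isomorphic opX opZ -> is_quandle opX -> is_quandle opZ.
Proof.
move=> isoXZ [rackX idemX]; split; first exact: rack_transport isoXZ rackX.
by move: isoXZ => [h [hM [g hK gK]]] p; rewrite -(gK p) -hM idemX.
Qed.

Lemma crossed_set_transport :
  rack_isomorphic opX opZ -> is_crossed_set opX -> is_crossed_set opZ.
Proof.
move=> isoXZ [quandleX fixX]; split; first exact: quandle_transport isoXZ quandleX.
move: isoXZ => [h [hM [g hK gK]]] p q; rewrite -(gK p) -(gK q) -!hM.
by move=> /(can_inj hK)/fixX ->.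
Qed.

End Transport.

Section CocycleOfExtension.

Variables (Y S : Type) (op : Y -> Y -> Y) (alpha : Y -> Y -> S -> S -> S).

(** Surjectivity of [alpha i j s] is the point where the base matters: a
    preimage of [(op i j, u)] under left multiplication by [(i, s)] could a
    priori lie over another [j'] with [op i j' = op i j]; injectivity of [op i]
    rules this out. *)
Lemma rack_cocycle_of_extension :
  is_rack op -> is_rack (extension_op op alpha) ->
  rack_dynamical_cocycle op alpha.
Proof.
move=> [_ bijY _] [_ bijE distE]; split; last first.
  by move=> i j k s t u; have [] := distE (i, s) (j, t) (k, u).
move=> i j s; have [d dK Kd] := bijE (i, s).
exists (fun u => (d (op i j, u)).2) => [t | u].
  by have := dK (j, t); rewrite /extension_op /= => ->.
have := Kd (op i j, u); case: (d _) => j' t [] /(bij_inj (bijY i)) -> /= <-.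
by [].
Qed.

Lemma quandle_cocycle_of_extension :
  is_quandle op -> is_quandle (extension_op op alpha) ->
  quandle_dynamical_cocycle op alpha.
Proof.
move=> [rackY _] [rackE idemE]; split; first exact: rack_cocycle_of_extension.
by move=> i s; have [] := idemE (i, s).
Qed.

Lemma crossed_set_cocycle_of_extension :
  is_crossed_set op -> is_crossed_set (extension_op op alpha) ->
  crossed_set_dynamical_cocycle op alpha.
Proof.
move=> [quandleY _] [quandleE fixE]; split.
  exact: quandle_cocycle_of_extension.
move=> i j s t ij_j alpha_t.
have /fixE[] // : extension_op op alpha (i, s) (j, t) = (j, t).
by rewrite /extension_op /= ij_j alpha_t.
Qed.

End CocycleOfExtension.

(** A map with equipotent fibers is a trivial bundle.  The model fiber is taken
    over a value [f x0], so that it is inhabited. *)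
Lemma equipotent_fibers_trivialization (X Y : Type) (f : X -> Y) (x0 : X) :
  equipotent_fibers f ->
  exists (S : Type) (h : X -> Y * S),
    [/\ inhabited S, bijective h & forall x, (h x).1 = f x].
Proof.
move=> eqf; pose fiber y : set X := (f @^-1` [set y])%classic.
have in_fiber x : x \in fiber (f x) by rewrite inE.
pose S : Type := fiber (f x0).
have bijS y : {b : (fiber y -> S) * (S -> fiber y) |
    cancel b.1 b.2 /\ cancel b.2 b.1}.
  apply: cid; have /card_bijP[phi [psi phiK psiK]] := eqf y (f x0).
  by exists (phi, psi).
pose phi y := (sval (bijS y)).1; pose psi y := (sval (bijS y)).2.
have phiK y : cancel (phi y) (psi y) := (svalP (bijS y)).1.
have psiK y : cancel (psi y) (phi y) := (svalP (bijS y)).2.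
exists S, (fun x => (f x, phi (f x) (exist _ x (in_fiber x)))).
split=> //; first by exists; exact: exist _ x0 (in_fiber x0).
exists (fun p => val (psi p.1 p.2)) => [x | [y s]] /=.
  by rewrite phiK.
(* The point [psi y s] of the fiber over [y] must be recognized in the fiber over
   its own image, so [y] is replaced by that image. *)
have: phi y (psi y s) = s by exact: psiK.
case: (psi y s) => x /= xy; have yE : f x = y by move: xy; rewrite inE.
by case: y / yE xy => xy <-; rewrite (bool_irrelevance (in_fiber x) xy).
Qed.

Lemma extension_of_equipotent_fibers (X Y : Type) (opX : X -> X -> X)
    (opY : Y -> Y -> Y) (f : X -> Y) :
  rack_morphism opX opY f -> is_rack opX -> equipotent_fibers f ->
  exists (S : Type) (alpha : Y -> Y -> S -> S -> S),
    inhabited S /\ rack_isomorphic opX (extension_op opY alpha).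
Proof.
move=> fM [[x0] _ _] /(equipotent_fibers_trivialization x0).
move=> [S [h [S0 [g hK gK] hf]]].
exists S, (fun i j s t => (h (opX (g (i, s)) (g (j, t)))).2); split=> //.
exists h; split; last by exists g.
move=> x x'; rewrite /extension_op -!surjective_pairing !hK !hf -fM.
by rewrite [LHS]surjective_pairing hf.
Qed.

(** Every [j] in [Z] is [op j k] for some [k], and [k] lies in [Z] because left
    multiplications also preserve [Z] backwards. *)
Lemma subrack_of_invariant (X : Type) (op : X -> X -> X) (Z : set X) :
  is_rack op -> (Z !=set0)%classic -> (forall i j, Z (op i j) <-> Z j) ->
  is_subrack op Z.
Proof.
move=> [_ bijX _] Z0 Zop; split=> //; apply/seteqP; split=> [k | j Zj].
  by move=> [i _ [j Zj <-]]; exact/Zop.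
have [d _ Kd] := bijX j; exists j => //; exists (d j) => //.
by apply/(Zop j); rewrite Kd.
Qed.

Lemma invariant_full_of_indecomposable (X : Type) (op : X -> X -> X)
    (Z : set X) :
  is_rack op -> indecomposable op -> (Z !=set0)%classic ->
  (forall i j, Z (op i j) <-> Z j) -> forall x, Z x.
Proof.
move=> rackX indec Z0 Zop x; apply: contrapT => nZx; apply: indec.
exists Z, (~` Z)%classic; split; [| | exact: setICr | exact: setUCr].
  exact: subrack_of_invariant.
apply: subrack_of_invariant => //; first by exists x.
by move=> i j; split; apply: contra_not => /Zop.
Qed.

Lemma left_mul_fiber_equipotent (X Y : Type) (opX : X -> X -> X)
    (opY : Y -> Y -> Y) (f : X -> Y) (i : X) (y : Y) :
  rack_morphism opX opY f -> is_rack opX -> is_rack opY ->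
  (f @^-1` [set y] #= f @^-1` [set opY (f i) y])%card.
Proof.
move=> fM [_ bijX _] [_ bijY _].
suff /bijPex[b] : exists g, set_bij (f @^-1` [set y])%classic
    (f @^-1` [set opY (f i) y])%classic g by exact: pcard_eq b.
exists (opX i); split=> [x /= <- | x x' _ _ | x /= fx]; first exact: fM.
  exact: bij_inj (bijX i) _ _.
have [d _ Kd] := bijX i; exists (d x) => //=.
by apply: (bij_inj (bijY (f i))); rewrite -fM Kd.
Qed.

Lemma equipotent_fibers_of_indecomposable (X Y : Type) (opX : X -> X -> X)
    (opY : Y -> Y -> Y) (f : X -> Y) :
  rack_morphism opX opY f -> (forall y : Y, exists x : X, f x = y) ->
  is_rack opX -> is_rack opY -> indecomposable opX -> equipotent_fibers f.
Proof.
move=> fM fsurj rackX rackY indec y y'.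
have [[x <-] [x' <-]] := (fsurj y, fsurj y').
pose Z : set X :=
  [set z | (f @^-1` [set f x] #= f @^-1` [set f z])%card]%classic.
apply: (@invariant_full_of_indecomposable _ opX Z) => //.
  by exists x; exact: card_eqxx.
move=> i j; rewrite /Z /= fM.
have ij := left_mul_fiber_equipotent i (f j) fM rackX rackY.
by split=> xj; apply: card_eq_trans xj _ => //; exact: card_esym.
Qed.

Theorem corollary2p5 (X Y : Type) (opX : X -> X -> X) (opY : Y -> Y -> Y)
    (f : X -> Y) (f_morphism : rack_morphism opX opY f)
    (f_surjective : forall y : Y, exists x : X, f x = y) :
  [/\ is_quandle opX -> is_quandle opY -> equipotent_fibers f ->
      exists (S : Type) (alpha : Y -> Y -> S -> S -> S),
        [/\ inhabited S, quandle_dynamical_cocycle opY alpha &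
            rack_isomorphic opX (extension_op opY alpha)],
      is_rack opX -> is_rack opY -> equipotent_fibers f ->
      exists (S : Type) (alpha : Y -> Y -> S -> S -> S),
        [/\ inhabited S, rack_dynamical_cocycle opY alpha &
            rack_isomorphic opX (extension_op opY alpha)],
      is_crossed_set opX -> is_crossed_set opY -> equipotent_fibers f ->
      exists (S : Type) (alpha : Y -> Y -> S -> S -> S),
        [/\ inhabited S, crossed_set_dynamical_cocycle opY alpha &
            rack_isomorphic opX (extension_op opY alpha)] &
      is_rack opX -> is_rack opY -> indecomposable opX ->
      equipotent_fibers f].

Proof.
split=> [quandleX quandleY eqf | rackX rackY eqf | crossedX crossedY eqf |].
- have rackX := quandle_rack quandleX.
  have [S [alpha [S0 iso]]] := extension_of_equipotent_fibers f_morphism rackX eqf.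
  exists S, alpha; split=> //; apply: quandle_cocycle_of_extension => //.
  exact: quandle_transport iso quandleX.
- have [S [alpha [S0 iso]]] := extension_of_equipotent_fibers f_morphism rackX eqf.
  exists S, alpha; split=> //; apply: rack_cocycle_of_extension => //.
  exact: rack_transport iso rackX.
- have rackX := quandle_rack (crossed_set_quandle crossedX).
  have [S [alpha [S0 iso]]] := extension_of_equipotent_fibers f_morphism rackX eqf.
  exists S, alpha; split=> //; apply: crossed_set_cocycle_of_extension => //.
  exact: crossed_set_transport iso crossedX.
- exact: equipotent_fibers_of_indecomposable.
Qed.
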